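(* Let $(f_h^n,E_h^n)_{n\ge0}$ be produced by the split discontinuous Galerkin (DG) scheme $\textbf{Scheme-4}(\Delta t)$ or $\textbf{Scheme-4F}(\Delta t)$ for the 1D1V Vlasov–Ampère system (defined in the context), with either upwind or central fluxes. Then the total particle number is preserved: $$\int_{\Omega_x}\int_{\Omega_v}f_h^{n+1}\,dv\,dx=\int_{\Omega_x}\int_{\Omega_v}f_h^{n}\,dv\,dx .$$
   Context: The 1D1V Vlasov–Ampère system is $\partial_tf+vf_x+Ef_v=0$, $\partial_tE=-J$, $J(x,t)=\int_{\Omega_v}f\,v\,dv$, on $\Omega_x\times\Omega_v=[0,L]\times[-V_c,V_c]$, periodic in $x$. Standing assumption: $V_c$ is so large that all numerical approximations of $f$ (including intermediate ones) vanish at $v=\pm V_c$ (zero traces, exterior value zero), so all numerical fluxes at $v=\pm V_c$ vanish. Grid: $0=x_{1/2}<\dots<x_{N_x+1/2}=L$, $-V_c=v_{1/2}<\dots<v_{N_v+1/2}=V_c$, $K_{x,i}=[x_{i-1/2},x_{i+1/2}]$, $K_{v,j}=[v_{j-1/2},v_{j+1/2}]$. For integer $k\ge0$: $x_i^{(l)}$ ($l=1,\dots,k+1$) and $v_j^{(m)}$ ($m=1,\dots,k+1$) are the $(k+1)$ Gauss quadrature points on $K_{x,i}$ and $K_{v,j}$ (the rule is exact for degree at most $2k+1$). Spaces: $\mathcal W_h^k$ (resp. $\mathcal Z_h^k$) consists of functions on $\Omega_x$ (resp. $\Omega_v$) that are polynomials of degree at most $k$ on each $K_{x,i}$ (resp.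 $K_{v,j}$); $\mathcal S_h^k$ consists of functions on $\Omega_x\times\Omega_v$ whose restriction to each $K_{x,i}\times K_{v,j}$ lies in the tensor product $P^k(K_{x,i})\otimes P^k(K_{v,j})$. Data: $f_h^0\in\mathcal S_h^k$, $E_h^0\in\mathcal W_h^k$. Superscripts $\pm$ denote right/left limits at grid points. Numerical fluxes: for a constant $c$ and a piecewise polynomial $g$, $\widehat{cg}$ at a grid point is either central, $\frac c2(g^++g^-)$, or upwind, $\frac c2(g^++g^-)-\frac{|c|}2(g^+-g^-)$. For negative time steps the upwind flux is replaced by the downwind flux (opposite sign of the jump term). $\textbf{Scheme-a}(\tau)$, mapping $(f_h^{\rm old},E_h^{\rm old})$ to $(f_h^{\rm new},E_h^{\rm new})$: for each $j,m$ find $g_j^{(m)}\in\mathcal W_h^k$ such that, with $\bar g(x)=\frac12\big(g_j^{(m)}(x)+f_h^{\rm old}(x,v_j^{(m)})\big)$, for all $i$ and all $\varphi\in\mathcal W_h^k$, $$\int_{K_{x,i}}\frac{g_j^{(m)}(x)-f_h^{\rm old}(x,v_j^{(m)})}{\tau}\varphi\,dx-\int_{K_{x,i}}v_j^{(m)}\bar g\,\varphi_x\,dx+\big(\widehat{v_j^{(m)}\bar g}\big)_{i+1/2}\varphi^-_{i+1/2}-\big(\widehat{v_j^{(m)}\bar g}\big)_{i-1/2}\varphi^+_{i-1/2}=0 .$$ Then $f_h^{\rm new}\in\mathcal S_h^k$ is the unique element with $f_h^{\rm new}(x_i^{(l)},v_j^{(m)})=g_j^{(m)}(x_i^{(l)})$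 for all $i,j,l,m$, and $E_h^{\rm new}=E_h^{\rm old}$. $\textbf{Scheme-b}(\tau)$: for each $i,l$ find $g_i^{(l)}\in\mathcal Z_h^k$ and $E_i^{(l)}\in\mathbb R$ such that, with $\bar g(v)=\frac12\big(g_i^{(l)}(v)+f_h^{\rm old}(x_i^{(l)},v)\big)$ and $\bar E=\frac12\big(E_h^{\rm old}(x_i^{(l)})+E_i^{(l)}\big)$, for all $j$ and all $\varphi\in\mathcal Z_h^k$, $$\int_{K_{v,j}}\frac{g_i^{(l)}(v)-f_h^{\rm old}(x_i^{(l)},v)}{\tau}\varphi\,dv-\int_{K_{v,j}}\bar E\,\bar g\,\varphi_v\,dv+\big(\widehat{\bar E\bar g}\big)_{j+1/2}\varphi^-_{j+1/2}-\big(\widehat{\bar E\bar g}\big)_{j-1/2}\varphi^+_{j-1/2}=0,$$ $$\frac{E_i^{(l)}-E_h^{\rm old}(x_i^{(l)})}{\tau}=-\tfrac12\big(J_h^{\rm old}(x_i^{(l)})+J_i^{(l)}\big),\quad J_h^{\rm old}(x)=\int_{\Omega_v}f_h^{\rm old}(x,v)v\,dv,\quad J_i^{(l)}=\int_{\Omega_v}g_i^{(l)}(v)v\,dv .$$ Then $f_h^{\rm new}\in\mathcal S_h^k$ and $E_h^{\rm new}\in\mathcal W_h^k$ are the unique elements with $f_h^{\rm new}(x_i^{(l)},v_j^{(m)})=g_i^{(l)}(v_j^{(m)})$ and $E_h^{\rm new}(x_i^{(l)})=E_i^{(l)}$ for all $i,j,l,m$. $\textbf{Scheme-4}(\tau)=\textbf{Scheme-a}(\tau/2)\,\textbf{Scheme-b}(\tau)\,\textbf{Scheme-a}(\tau/2)$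 and $\textbf{Scheme-4F}(\tau)=\textbf{Scheme-4}(\beta_1\tau)\,\textbf{Scheme-4}(\beta_2\tau)\,\textbf{Scheme-4}(\beta_3\tau)$ (compositions), with $\beta_1=\beta_3=(2+2^{1/3}+2^{-1/3})/3$, $\beta_2=1-2\beta_1<0$. Since the schemes are implicit, any sequence satisfying the equations is meant. *)

(* Defs.v *)
From mathcomp Require Import all_boot all_order all_algebra.
From mathcomp Require Import all_classical all_reals all_analysis.

Set Implicit Arguments.
Unset Strict Implicit.
Unset Printing Implicit Defensive.

Import Order.TTheory GRing.Theory Num.Theory.
Local Open Scope ring_scope.
Local Open Scope classical_set_scope.

(* ** One-dimensional meshes with their Gauss points *)

(* The n-point Gauss rule on [a, b], characterized by its maximal degree of
   exactness 2n - 1 (size of a polynomial = degree + 1). *)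
Definition gauss_points (R : realType) (n : nat) (a b : R) (g : 'I_n -> R) :
    Prop :=
  [/\ forall l, a <= g l <= b,
      forall l m : 'I_n, (l < m)%N -> g l < g m
    & exists w : 'I_n -> R, forall p : {poly R}, (size p <= n.*2)%N ->
        \int[lebesgue_measure]_(x in `[a, b]) p.[x]
        = \sum_(l < n) w l * p.[g l]].

(* [node n] is the grid point x_{n+1/2}; only 0 <= n <= ncell is meaningful.
   Cell number i (counted from 0) is [node i, node i.+1]. *)
Record mesh (R : realType) (a b : R) (k : nat) := Mesh {
  ncell : nat;
  node : nat -> R;
  gpt : 'I_ncell -> 'I_k.+1 -> R;
  node_first : node 0%N = a;
  node_last : node ncell = b;
  node_lt : forall i : 'I_ncell, node i < node i.+1;
  gptP : forall i : 'I_ncell, gauss_points (node i) (node i.+1) (gpt i) }.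

Arguments ncell {R a b k} m.
Arguments node {R a b k} m _.
Arguments gpt {R a b k} m _ _.

(* ** Broken polynomial spaces *)

(* A piecewise polynomial is the family of its restrictions to the cells, so
   that it may be double-valued at the grid points. *)
Definition pwpoly (R : realType) (a b : R) (k : nat) (M : mesh a b k) : Type :=
  'I_(ncell M) -> {poly R}.

(* On a rectangle the outer variable of {poly {poly R}} is x and the inner one
   is v, so that (f i j).[x, v] is the value of f at (x, v). *)
Definition pwpoly2 (R : realType) (a b c d : R) (k : nat)
    (Mx : mesh a b k) (Mv : mesh c d k) : Type :=
  'I_(ncell Mx) -> 'I_(ncell Mv) -> {poly {poly R}}.

Definition in_Pk (R : realType) (a b : R) (k : nat) (M : mesh a b k)
    (g : pwpoly M) : Prop :=
  forall i, (size (g i) <= k.+1)%N.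

Definition in_Qk (R : realType) (a b c d : R) (k : nat)
    (Mx : mesh a b k) (Mv : mesh c d k) (f : pwpoly2 Mx Mv) : Prop :=
  forall i j, (size (f i j) <= k.+1)%N /\ (sizeY (f i j) <= k.+1)%N.

(* The function f(x, .), for x in the i-th x-cell. *)
Definition slice_v (R : realType) (a b c d : R) (k : nat)
    (Mx : mesh a b k) (Mv : mesh c d k) (f : pwpoly2 Mx Mv)
    (i : 'I_(ncell Mx)) (x : R) : pwpoly Mv :=
  fun j => (f i j).[x%:P].

(* The function f(., v), for v in the j-th v-cell. *)
Definition slice_x (R : realType) (a b c d : R) (k : nat)
    (Mx : mesh a b k) (Mv : mesh c d k) (f : pwpoly2 Mx Mv)
    (j : 'I_(ncell Mv)) (v : R) : pwpoly Mx :=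
  fun i => (swapXY (f i j)).[v%:P].

(* The function on the whole domain given by a family; at a grid point (a null
   set) the cell on the right is used, and 0 at the last grid point. *)
Definition pwfun (R : realType) (a b : R) (k : nat) (M : mesh a b k)
    (g : pwpoly M) (x : R) : R :=
  \sum_(i < ncell M) (if node M i <= x < node M i.+1 then (g i).[x] else 0).

Definition pwfun2 (R : realType) (a b c d : R) (k : nat)
    (Mx : mesh a b k) (Mv : mesh c d k) (f : pwpoly2 Mx Mv) (x v : R) : R :=
  \sum_(i < ncell Mx) \sum_(j < ncell Mv)
    (if (node Mx i <= x < node Mx i.+1) && (node Mv j <= v < node Mv j.+1)
     then (f i j).[x, v] else 0).

(* ** Traces and numerical fluxes *)

Inductive boundary := Periodic | ZeroExterior.

Definition cellpoly (R : realType) (a b : R) (k : nat) (M : mesh a b k)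
    (g : pwpoly M) (n : nat) : {poly R} := oapp g 0 (insub n).

(* g^- at [node n]; at n = 0 it is the exterior value. *)
Definition left_trace (R : realType) (a b : R) (k : nat) (M : mesh a b k)
    (bc : boundary) (g : pwpoly M) (n : nat) : R :=
  if n is n'.+1 then (cellpoly g n').[node M n]
  else if bc is Periodic then (cellpoly g (ncell M).-1).[node M (ncell M)]
  else 0.

(* g^+ at [node n]; at n = ncell M it is the exterior value. *)
Definition right_trace (R : realType) (a b : R) (k : nat) (M : mesh a b k)
    (bc : boundary) (g : pwpoly M) (n : nat) : R :=
  if (n < ncell M)%N then (cellpoly g n).[node M n]
  else if bc is Periodic then (cellpoly g 0%N).[node M 0%N]
  else 0.

Inductive flux_kind := Central | Upwind.

(* For a negative time step tau the upwind flux becomes the downwind one. *)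
Definition num_flux (R : realType) (a b : R) (k : nat) (M : mesh a b k)
    (bc : boundary) (fl : flux_kind) (tau c : R) (g : pwpoly M) (n : nat) : R :=
  let gm := left_trace bc g n in
  let gp := right_trace bc g n in
  match fl with
  | Central => c / 2 * (gp + gm)
  | Upwind => c / 2 * (gp + gm) - Num.sg tau * (`|c| / 2 * (gp - gm))
  end.

(* ** The split schemes *)

Definition midpoint (R : realType) (a b : R) (k : nat) (M : mesh a b k)
    (gold gnew : pwpoly M) : pwpoly M :=
  fun i => 2^-1 *: (gnew i + gold i).

(* Implicit midpoint DG discretization of g_t + c g_y = 0 over a time step tau,
   with c constant. *)
Definition dg_advection (R : realType) (a b : R) (k : nat) (M : mesh a b k)
    (bc : boundary) (fl : flux_kind) (tau c : R) (gold gnew : pwpoly M) :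
    Prop :=
  let gbar := midpoint gold gnew in
  let F := num_flux bc fl tau c gbar in
  forall (i : 'I_(ncell M)) (phi : pwpoly M), in_Pk phi ->
    \int[lebesgue_measure]_(y in `[node M i, node M i.+1])
        (((gnew i).[y] - (gold i).[y]) / tau * (phi i).[y])
    - \int[lebesgue_measure]_(y in `[node M i, node M i.+1])
        (c * (gbar i).[y] * (phi i)^`().[y])
    + F i.+1 * (phi i).[node M i.+1] - F i * (phi i).[node M i] = 0.

Definition state (R : realType) (a b c d : R) (k : nat)
    (Mx : mesh a b k) (Mv : mesh c d k) : Type :=
  (pwpoly2 Mx Mv * pwpoly Mx)%type.

Definition current (R : realType) (c d : R) (k : nat) (Mv : mesh c d k)
    (g : pwpoly Mv) : R :=
  \int[lebesgue_measure]_(v in `[c, d]) (pwfun g v * v).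

Definition scheme_a (R : realType) (a b c d : R) (k : nat)
    (Mx : mesh a b k) (Mv : mesh c d k) (fl : flux_kind) (tau : R)
    (s s' : state Mx Mv) : Prop :=
  exists g : 'I_(ncell Mv) -> 'I_k.+1 -> pwpoly Mx,
    [/\ forall j m, in_Pk (g j m),
        forall j m, dg_advection Periodic fl tau (gpt Mv j m)
                      (slice_x s.1 j (gpt Mv j m)) (g j m),
        in_Qk s'.1,
        forall i j l m,
          (s'.1 i j).[gpt Mx i l, gpt Mv j m] = (g j m i).[gpt Mx i l]
      & s'.2 = s.2].

Definition scheme_b (R : realType) (a b c d : R) (k : nat)
    (Mx : mesh a b k) (Mv : mesh c d k) (fl : flux_kind) (tau : R)
    (s s' : state Mx Mv) : Prop :=
  let fold := fun i l => slice_v s.1 i (gpt Mx i l) in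
  let Eold := fun i l => (s.2 i).[gpt Mx i l] in
  exists (g : 'I_(ncell Mx) -> 'I_k.+1 -> pwpoly Mv)
         (E : 'I_(ncell Mx) -> 'I_k.+1 -> R),
    [/\ forall i l, in_Pk (g i l),
        forall i l, dg_advection ZeroExterior fl tau ((Eold i l + E i l) / 2)
                      (fold i l) (g i l),
        forall i l, (E i l - Eold i l) / tau
                    = - (2^-1 * (current (fold i l) + current (g i l))),
        in_Qk s'.1 /\ in_Pk s'.2
      & forall i l, (s'.2 i).[gpt Mx i l] = E i l /\
          forall j m,
            (s'.1 i j).[gpt Mx i l, gpt Mv j m] = (g i l j).[gpt Mv j m]].

(* f vanishes at both ends of the velocity domain, for every x. *)
Definition zero_at_v_boundary (R : realType) (a b c d : R) (k : nat)
    (Mx : mesh a b k) (Mv : mesh c d k) (f : pwpoly2 Mx Mv) : Prop :=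
  forall (i : 'I_(ncell Mx)) (x : R), node Mx i <= x <= node Mx i.+1 ->
    right_trace ZeroExterior (slice_v f i x) 0%N = 0 /\
    left_trace ZeroExterior (slice_v f i x) (ncell Mv) = 0.

(* A after B, the intermediate approximation of f being required to vanish at
   the ends of the velocity domain. *)
Definition compose (R : realType) (a b c d : R) (k : nat)
    (Mx : mesh a b k) (Mv : mesh c d k)
    (A B : state Mx Mv -> state Mx Mv -> Prop) (s s' : state Mx Mv) : Prop :=
  exists s1 : state Mx Mv, [/\ B s s1, zero_at_v_boundary s1.1 & A s1 s'].

Definition scheme_4 (R : realType) (a b c d : R) (k : nat)
    (Mx : mesh a b k) (Mv : mesh c d k) (fl : flux_kind) (tau : R) :
    state Mx Mv -> state Mx Mv -> Prop :=
  compose (scheme_a fl (tau / 2))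
    (compose (scheme_b fl tau) (scheme_a fl (tau / 2))).

Definition beta1 (R : realType) : R := (2 + 2 `^ (3^-1) + 2 `^ (- 3^-1)) / 3.
Definition beta2 (R : realType) : R := 1 - 2 * beta1 R.
Definition beta3 (R : realType) : R := beta1 R.

Definition scheme_4F (R : realType) (a b c d : R) (k : nat)
    (Mx : mesh a b k) (Mv : mesh c d k) (fl : flux_kind) (tau : R) :
    state Mx Mv -> state Mx Mv -> Prop :=
  compose (scheme_4 fl (beta1 R * tau))
    (compose (scheme_4 fl (beta2 R * tau)) (scheme_4 fl (beta3 R * tau))).

(* Main.v *)
(** The total mass of [f] in the tensor space [Q_k] equals its tensor Gauss sum,
    since the rule is exact beyond degree [k].  Testing one implicit midpoint
    step with the constant function 1 makes the fluxes telescope, so the step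
    changes the integral only by the difference of the two boundary fluxes:
    these coincide by periodicity in [x], and vanish in [v].  Hence each split
    step preserves the Gauss sums along the lines through Gauss points of the
    other variable, whatever the flux, the field and the (nonzero) time step. *)

Require Import Defs.
From mathcomp Require Import all_boot all_order all_algebra.
From mathcomp Require Import all_classical all_reals all_analysis.
From mathcomp Require Import lra.

Set Implicit Arguments.
Unset Strict Implicit.
Unset Printing Implicit Defensive.

Import Order.TTheory GRing.Theory Num.Theory.
Local Open Scope ring_scope.
Local Open Scope classical_set_scope.

(** * Integration of finite sums and of polynomials cut off to a cell *)

Lemma Rintegral_sum d (T : measurableType d) (R : realType)
    (mu : {measure set T -> \bar R}) (D : set T) (I : Type) (s : seq I)
    (f : I -> T -> R) :
  measurable D -> (forall i, mu.-integrable D (EFin \o f i)) ->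
  \int[mu]_(x in D) (\sum_(i <- s) f i x)
  = \sum_(i <- s) \int[mu]_(x in D) f i x.
Proof.
move=> mD fi; elim: s => [|i s IHs].
  (* The integral of 0 is read off from that of a constant, as 0 times [fine (mu D)]. *)
  rewrite big_nil -[RHS](mul0r (fine (mu D))) -Rintegral_cst //.
  by apply: eq_Rintegral => x _; rewrite big_nil.
rewrite big_cons -IHs -RintegralD //.
  by apply: eq_Rintegral => x _; rewrite big_cons.
rewrite (_ : EFin \o _ = fun x => (\sum_(i <- s) (EFin \o f i) x)%E).
  exact: integrable_sum.
by apply/funext => x /=; rewrite sumEFin.
Qed.

Lemma integrable_horner (R : realType) (a b : R) (p : {poly R}) :
  lebesgue_measure.-integrable `[a, b] (EFin \o horner p).
Proof.
apply: continuous_compact_integrable; first exact: segment_compact.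
by apply: continuous_subspaceT; exact: continuous_horner.
Qed.

Lemma integrable_cell (R : realType) (a b : R) (D : set R) (p : {poly R}) :
  measurable D ->
  lebesgue_measure.-integrable D
    (EFin \o (fun x => if a <= x < b then p.[x] else 0)).
Proof.
move=> mD.
rewrite (_ : EFin \o _ = (EFin \o horner p) \_ `[a, b[); last first.
  apply/funext => x /=; rewrite patchE mem_setE in_itv /=.
  by case: ifP.
apply: (@integrableS _ _ _ lebesgue_measure setT) => //.
rewrite -integrable_mkcond //.
apply: (@integrableS _ _ _ lebesgue_measure `[a, b]) => //.
  by apply: subset_itvl; rewrite bnd_simp.
exact: integrable_horner.
Qed.

(** * One mesh: Gauss weights, unisolvence and the mass balance of one advection step *)

Section Mesh.
Variables (R : realType) (a b : R) (k : nat) (M : mesh a b k).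

Lemma node_le (m n : nat) :
  (m <= n)%N -> (n <= ncell M)%N -> node M m <= node M n.
Proof.
elim: n => [|n IHn]; first by rewrite leqn0 => /eqP ->.
rewrite leq_eqVlt ltnS => /predU1P[-> //|le_mn] lt_n.
apply: le_trans (IHn le_mn (ltnW lt_n)) (ltW _).
exact: (node_lt (Ordinal lt_n)).
Qed.

Definition gauss_weights (w : 'I_(ncell M) -> 'I_k.+1 -> R) : Prop :=
  forall (i : 'I_(ncell M)) (p : {poly R}), (size p <= k.+1.*2)%N ->
    \int[lebesgue_measure]_(x in `[node M i, node M i.+1]) p.[x]
    = \sum_l w i l * p.[gpt M i l].

(** [gauss_points] only asserts that weights exist on each cell; finite choice gives one family for
    the whole mesh, so that sums over cells can be formed. *)
Lemma gauss_weightsP : exists w, gauss_weights w.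
Proof.
have /fin_all_exists [w wP] : forall i : 'I_(ncell M),
    exists w : 'I_k.+1 -> R, forall p : {poly R}, (size p <= k.+1.*2)%N ->
      \int[lebesgue_measure]_(x in `[node M i, node M i.+1]) p.[x]
      = \sum_l w l * p.[gpt M i l].
  by move=> i; case: (gptP i).
by exists w.
Qed.

Lemma gpt_inj (i : 'I_(ncell M)) : injective (gpt M i).
Proof.
case: (gptP i) => _ lt_gpt _ l m eq_lm.
apply/eqP/negPn; rewrite neq_ltn.
by apply/negP=> /orP[] /lt_gpt; rewrite eq_lm ltxx.
Qed.

(** The difference has degree at most k and vanishes at k + 1 distinct points. *)
Lemma eq_poly_gpt (i : 'I_(ncell M)) (p q : {poly R}) :
    (size p <= k.+1)%N -> (size q <= k.+1)%N ->
  (forall l, p.[gpt M i l] = q.[gpt M i l]) -> p = q.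
Proof.
move=> sp sq eq_pq; apply/eqP; rewrite -subr_eq0; apply/eqP.
pose rs := [seq gpt M i l | l <- enum 'I_k.+1].
apply: (@roots_geq_poly_eq0 _ _ rs).
- by apply/allP => _ /mapP[l _ ->]; rewrite rootE !hornerE eq_pq subrr.
- by rewrite map_inj_uniq ?enum_uniq //; exact: gpt_inj.
- rewrite size_map size_enum_ord.
  by rewrite (leq_trans (size_polyD _ _)) // size_polyN geq_max sp.
Qed.

(** The sum in [pwfun] is integrated termwise; closing each half-open cell adds a single point,
    which is a null set. *)
Lemma Rintegral_pwfun (g : pwpoly M) :
  \int[lebesgue_measure]_(x in `[a, b]) pwfun g x
  = \sum_(i < ncell M)
      \int[lebesgue_measure]_(x in `[node M i, node M i.+1]) (g i).[x].
Proof.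
rewrite Rintegral_sum //; last by move=> i; exact: integrable_cell.
apply: eq_bigr => i _.
rewrite -[RHS]Rintegral_itv_bndo_bndc; last first.
  apply: (@integrableS _ _ _ lebesgue_measure `[node M i, node M i.+1]) => //.
    by apply: subset_itvl; rewrite bnd_simp.
  exact: integrable_horner.
(* Monotonicity of the nodes places the cell inside [a, b], so integrating the cut-off polynomial
   over [a, b] is integrating over the cell. *)
have -> : `[node M i, node M i.+1[ =
    `[a, b] `&` `[node M i, node M i.+1[ :> set R.
  apply/esym/setIidr => x /=; rewrite !in_itv /= => /andP[ax xb].
  rewrite -(node_first M) (le_trans _ ax) ?node_le ?(ltnW (ltn_ord i)) //=.
  by rewrite -(node_last M) (le_trans (ltW xb)) // node_le.
rewrite Rintegral_mkcondr; apply: eq_Rintegral => x _.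
by rewrite patchE mem_setE in_itv.
Qed.

(** Equality of the two end fluxes is a hypothesis, so that one balance serves both the periodic
    direction and the one with zero exterior values. *)
Lemma dg_advection_mass (w : 'I_(ncell M) -> 'I_k.+1 -> R) (bc : boundary)
    (fl : flux_kind) (tau c : R) (gold gnew : pwpoly M) :
    gauss_weights w -> tau != 0 -> in_Pk gold -> in_Pk gnew ->
    num_flux bc fl tau c (midpoint gold gnew) (ncell M)
    = num_flux bc fl tau c (midpoint gold gnew) 0 ->
    dg_advection bc fl tau c gold gnew ->
  \sum_i \sum_l w i l * (gnew i).[gpt M i l]
  = \sum_i \sum_l w i l * (gold i).[gpt M i l].
Proof.
set F := num_flux _ _ _ _ _ => wP tau0 Pold Pnew eqF dg.
have cell_balance (i : 'I_(ncell M)) : \sum_l w i l * (gnew i).[gpt M i l]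
    - \sum_l w i l * (gold i).[gpt M i l] = - (tau * (F i.+1 - F i)).
  have P1 : in_Pk ((fun=> 1) : pwpoly M) by move=> ?; rewrite size_poly1.
  have := dg i _ P1; rewrite -/F.
  have -> : \int[lebesgue_measure]_(y in `[node M i, node M i.+1])
      (c * (midpoint gold gnew i).[y] * (1 : {poly R})^`().[y]) = 0.
    rewrite -[RHS](mul0r (fine (lebesgue_measure `[node M i, node M i.+1]))).
    rewrite -Rintegral_cst //; apply: eq_Rintegral => y _.
    by rewrite derivC horner0 mulr0.
  have -> : \int[lebesgue_measure]_(y in `[node M i, node M i.+1])
      (((gnew i).[y] - (gold i).[y]) / tau * (1 : {poly R}).[y])
    = tau^-1 * (\sum_l w i l * (gnew i).[gpt M i l]
                - \sum_l w i l * (gold i).[gpt M i l]).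
    transitivity (\int[lebesgue_measure]_(y in `[node M i, node M i.+1])
        (tau^-1 *: (gnew i - gold i)).[y]).
      by apply: eq_Rintegral => y _; rewrite !hornerE mulrC.
    rewrite wP; last first.
      rewrite (leq_trans (size_scale_leq _ _)) //.
      rewrite (leq_trans (size_polyD _ _)) // size_polyN geq_max.
      by rewrite -addnn !(leq_trans _ (leq_addr _ _)).
    rewrite -sumrB mulr_sumr; apply: eq_bigr => l _.
    by rewrite hornerZ hornerD hornerN -mulrBr mulrCA.
  rewrite subr0 !hornerC !mulr1 => eq0.
  (* Here [tau != 0] is essential: since division by 0 gives 0, a zero step would leave the
     increment uncontrolled. *)
  apply: (mulfI (invr_neq0 tau0)); rewrite mulrN mulKf //.
  by apply/eqP; rewrite -addr_eq0 addrA; apply/eqP.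
apply/eqP; rewrite -subr_eq0 -sumrB (eq_bigr _ (fun i _ => cell_balance i)).
rewrite sumrN -mulr_sumr -(big_mkord xpredT (fun i => F i.+1 - F i)).
by rewrite telescope_sumr // eqF subrr mulr0 oppr0.
Qed.

End Mesh.

(** * Numerical fluxes at the two ends of a mesh *)

Lemma num_flux_periodic (R : realType) (a b : R) (k : nat) (M : mesh a b k)
    (fl : flux_kind) (tau c : R) (g : pwpoly M) :
  num_flux Periodic fl tau c g (ncell M) = num_flux Periodic fl tau c g 0.
Proof.
have eq_left : left_trace Periodic g (ncell M) = left_trace Periodic g 0.
  by rewrite /left_trace; case: (ncell M).
have eq_right : right_trace Periodic g (ncell M) = right_trace Periodic g 0.
  by rewrite /right_trace ltnn; case: ifP.
by rewrite /num_flux eq_left eq_right.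
Qed.

Lemma cellpoly_midpoint (R : realType) (a b : R) (k : nat) (M : mesh a b k)
    (g h : pwpoly M) (n : nat) :
  cellpoly (midpoint g h) n = 2^-1 *: (cellpoly h n + cellpoly g n).
Proof.
by rewrite /cellpoly; case: insub => //=; rewrite addr0 scaler0.
Qed.

(** The outer traces vanish by definition and the inner ones by linearity of the midpoint, so the
    average and the jump are both zero. *)
Lemma num_flux_zero_exterior (R : realType) (a b : R) (k : nat)
    (M : mesh a b k) (fl : flux_kind) (tau c : R) (g h : pwpoly M) :
    right_trace ZeroExterior g 0 = 0 -> right_trace ZeroExterior h 0 = 0 ->
    left_trace ZeroExterior g (ncell M) = 0 ->
    left_trace ZeroExterior h (ncell M) = 0 ->
  num_flux ZeroExterior fl tau c (midpoint g h) 0 = 0 /\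
  num_flux ZeroExterior fl tau c (midpoint g h) (ncell M) = 0.
Proof.
move=> g0 h0 gN hN.
have left0 : left_trace ZeroExterior (midpoint g h) (ncell M) = 0.
  move: gN hN; rewrite /left_trace; case: (ncell M) => // n gN hN.
  by rewrite cellpoly_midpoint hornerZ hornerD gN hN addr0 mulr0.
have right0 : right_trace ZeroExterior (midpoint g h) 0 = 0.
  move: g0 h0; rewrite /right_trace; case: ifP => // _ g0 h0.
  by rewrite cellpoly_midpoint hornerZ hornerD g0 h0 addr0 mulr0.
have rightN : right_trace ZeroExterior (midpoint g h) (ncell M) = 0.
  by rewrite /right_trace ltnn.
(* The remaining trace, on the left of node 0, is the exterior value and reduces to 0 by
   computation. *)
by rewrite /num_flux left0 right0 rightN; case: fl; rewrite !(addr0, subr0, mulr0).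
Qed.

(** * Total mass as a tensor Gauss sum *)

Section PhaseSpace.
Variables (R : realType) (a b c d : R) (k : nat).
Variables (Mx : mesh a b k) (Mv : mesh c d k).
Variables (wx : 'I_(ncell Mx) -> 'I_k.+1 -> R).
Variables (wv : 'I_(ncell Mv) -> 'I_k.+1 -> R).
Hypotheses (wxP : gauss_weights wx) (wvP : gauss_weights wv).

Definition gauss_mass (f : pwpoly2 Mx Mv) : R :=
  \sum_i \sum_l wx i l *
    \sum_j \sum_m wv j m * (f i j).[gpt Mx i l, gpt Mv j m].

(** Scheme-a acts along x for a fixed Gauss velocity, so its analysis needs the sum over x
    innermost; Scheme-b uses the original order. *)
Lemma gauss_massC (f : pwpoly2 Mx Mv) :
  gauss_mass f = \sum_j \sum_m wv j m *
    \sum_i \sum_l wx i l * (f i j).[gpt Mx i l, gpt Mv j m].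
Proof.
rewrite /gauss_mass.
under eq_bigr do under eq_bigr do rewrite mulr_sumr.
under [RHS]eq_bigr do under eq_bigr do rewrite mulr_sumr.
under eq_bigr do under eq_bigr do under eq_bigr do rewrite mulr_sumr.
under [RHS]eq_bigr do under eq_bigr do under eq_bigr do rewrite mulr_sumr.
under eq_bigr do rewrite exchange_big.
rewrite exchange_big /=; apply: eq_bigr => j _.
under eq_bigr do rewrite exchange_big.
rewrite exchange_big /=; do 3!apply: eq_bigr => ? _.
by rewrite mulrCA.
Qed.

Lemma in_Pk_slice_v (f : pwpoly2 Mx Mv) (i : 'I_(ncell Mx)) (x : R) :
  in_Qk f -> in_Pk (slice_v f i x).
Proof.
by move=> Qf j; case: (Qf i j) => _; apply: leq_trans; exact: max_size_evalC.
Qed.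

Lemma in_Pk_slice_x (f : pwpoly2 Mx Mv) (j : 'I_(ncell Mv)) (v : R) :
  in_Qk f -> in_Pk (slice_x f j v).
Proof.
move=> Qf i; case: (Qf i j) => sf _; apply: leq_trans sf.
by rewrite (leq_trans (max_size_evalC _ _)) // sizeYE swapXYK.
Qed.

(** The Gauss rule is applied in v for fixed x, then in x to the resulting piecewise polynomial.
    Cells are half-open in both [pwfun] and [pwfun2], so the inner identity holds at every x, grid
    points included. *)
Lemma double_integralE (f : pwpoly2 Mx Mv) : in_Qk f ->
  \int[lebesgue_measure]_(x in `[a, b])
    \int[lebesgue_measure]_(v in `[c, d]) pwfun2 f x v = gauss_mass f.
Proof.
move=> Qf; have leP (n : nat) : (n <= k.+1 -> n <= k.+1.*2)%N.
  by move=> le_n; rewrite (leq_trans le_n) // -addnn leq_addr.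
(* The inner integral over v, as a piecewise polynomial in x. *)
pose P : pwpoly Mx := fun i => \sum_j \sum_m wv j m *: slice_x f j (gpt Mv j m) i.
have sizeP i : (size (P i) <= k.+1)%N.
  rewrite (leq_trans (size_sum _ _ _)) //; apply/bigmax_leqP => j _.
  rewrite (leq_trans (size_sum _ _ _)) //; apply/bigmax_leqP => m _.
  by rewrite (leq_trans (size_scale_leq _ _)) // in_Pk_slice_x.
transitivity (\int[lebesgue_measure]_(x in `[a, b]) pwfun P x); last first.
  rewrite Rintegral_pwfun; apply: eq_bigr => i _.
  rewrite wxP ?leP //; apply: eq_bigr => l _; congr (_ * _).
  rewrite horner_sum; apply: eq_bigr => j _.
  rewrite horner_sum; apply: eq_bigr => m _.
  by rewrite hornerZ horner2_swapXY.
apply: eq_Rintegral => x _.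
(* The sum over [i] selects the cell containing [x]; it is empty at the last grid point, where [h]
   is 0. *)
pose h : pwpoly Mv := fun j => \sum_(i < ncell Mx)
  (if node Mx i <= x < node Mx i.+1 then slice_v f i x j else 0).
have sizeh j : (size (h j) <= k.+1)%N.
  rewrite (leq_trans (size_sum _ _ _)) //; apply/bigmax_leqP => i _.
  by case: ifP => _; rewrite ?size_poly0 // in_Pk_slice_v.
transitivity (\int[lebesgue_measure]_(v in `[c, d]) pwfun h v).
  apply: eq_Rintegral => v _; rewrite /pwfun2 exchange_big /=.
  apply: eq_bigr => j _; case: ifP => vj; last first.
    by rewrite big1 // => i _; rewrite andbF.
  rewrite horner_sum; apply: eq_bigr => i _.
  by rewrite andbT; case: ifP; rewrite ?horner0.
rewrite Rintegral_pwfun.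
under eq_bigr => j _ do rewrite wvP ?leP // /h.
rewrite /pwfun /P.
transitivity (\sum_j \sum_m \sum_(i < ncell Mx)
    (if node Mx i <= x < node Mx i.+1
     then wv j m * (f i j).[x, gpt Mv j m] else 0)).
  apply: eq_bigr => j _; apply: eq_bigr => m _.
  rewrite horner_sum mulr_sumr; apply: eq_bigr => i _.
  by case: ifP; rewrite ?horner0 ?mulr0.
under eq_bigr do rewrite exchange_big.
rewrite exchange_big /=; apply: eq_bigr => i _.
case: ifP => _; last by rewrite big1 // => j _; rewrite big1.
rewrite horner_sum; apply: eq_bigr => j _.
rewrite horner_sum; apply: eq_bigr => m _.
by rewrite hornerZ horner2_swapXY.
Qed.

(** * Conservation by the split steps and their compositions *)

Definition conserves_mass (A : state Mx Mv -> state Mx Mv -> Prop) : Prop :=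
  forall s s', in_Qk s.1 -> zero_at_v_boundary s.1 ->
    zero_at_v_boundary s'.1 -> A s s' ->
    in_Qk s'.1 /\ gauss_mass s'.1 = gauss_mass s.1.

(** The intermediate state inherits its degree bound from the conclusion for [B] and its zero
    boundary values from [compose]; this is why [conserves_mass] also asserts [in_Qk] of the new
    state. *)
Lemma compose_conserves_mass (A B : state Mx Mv -> state Mx Mv -> Prop) :
  conserves_mass A -> conserves_mass B -> conserves_mass (compose A B).
Proof.
move=> consA consB s s' Qs s0 s'0 [s1 [Bs s10 As]].
have [Qs1 <-] := consB _ _ Qs s0 s10 Bs.
exact: consA As.
Qed.

Lemma scheme_a_conserves_mass (fl : flux_kind) (tau : R) :
  tau != 0 -> conserves_mass (scheme_a fl tau).
Proof.
move=> tau0 s s' Qs _ _ [g [Pg dg Qs' s'E _]]; split=> //.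
rewrite !gauss_massC; apply: eq_bigr => j _; apply: eq_bigr => m _.
congr (_ * _).
have := dg_advection_mass wxP tau0 (in_Pk_slice_x j _ Qs) (Pg j m)
  (num_flux_periodic _ _ _ _) (dg j m).
(* The line solutions [g j m] enter only through their values at Gauss points, which are those of
   the new state. *)
under eq_bigr => i _ do under eq_bigr => l _ do rewrite -s'E.
move=> ->; apply: eq_bigr => i _; apply: eq_bigr => l _.
by rewrite horner2_swapXY.
Qed.

(** On the line through a Gauss point in x the averaged field is a single number, although it
    involves the unknown [E i l]; the step is thus an advection in v with constant coefficient. *)
Lemma scheme_b_conserves_mass (fl : flux_kind) (tau : R) :
  tau != 0 -> conserves_mass (scheme_b fl tau).
Proof.
move=> tau0 s s' Qs s0 s'0 [g [E [Pg dg _ [Qs' _] s'E]]]; split=> //.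
apply: eq_bigr => i _; apply: eq_bigr => l _; congr (_ * _).
have in_cell : node Mx i <= gpt Mx i l <= node Mx i.+1.
  by case: (gptP i).
(* This identifies the traces of [g i l] at the ends of the velocity domain,
   on which the hypotheses only speak through [s'.1]. *)
have gE : slice_v s'.1 i (gpt Mx i l) = g i l.
  apply/funext => j; apply: (@eq_poly_gpt _ _ _ _ Mv j).
  - exact: in_Pk_slice_v.
  - exact: Pg.
  - by move=> m; case: (s'E i l) => _ ->.
have [old0 oldN] := s0 i _ in_cell.
have [new0 newN] := s'0 i _ in_cell.
have [flux0 fluxN] := num_flux_zero_exterior fl tau
  (((s.2 i).[gpt Mx i l] + E i l) / 2) old0 new0 oldN newN.
(* Evaluation at a pair is by definition evaluation of the slice, so the change of form is a
   conversion. *)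
rewrite -[LHS]/(\sum_j \sum_m wv j m *
  (slice_v s'.1 i (gpt Mx i l) j).[gpt Mv j m]).
have := dg i l; rewrite -gE.
apply: (dg_advection_mass wvP tau0 (in_Pk_slice_v _ _ Qs) (in_Pk_slice_v _ _ Qs')).
by rewrite fluxN flux0.
Qed.

Lemma scheme_4_conserves_mass (fl : flux_kind) (tau : R) :
  tau != 0 -> conserves_mass (scheme_4 fl tau).
Proof.
move=> tau0; have half0 : tau / 2 != 0 by rewrite mulf_neq0 ?invr_eq0 ?pnatr_eq0.
apply: compose_conserves_mass; first exact: scheme_a_conserves_mass.
apply: compose_conserves_mass; first exact: scheme_b_conserves_mass.
exact: scheme_a_conserves_mass.
Qed.

(** Both powers of 2 are positive. A bound above 1/2 makes [beta1] positive and [beta2] negative, so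
    no substep of [scheme_4F] has length zero. *)
Lemma beta1_gt : 2 / 3 < beta1 R.
Proof.
rewrite /beta1 ltr_pM2r ?invr_gt0 ?ltr0n // -addrA ltrDl.
by rewrite addr_gt0 // powR_gt0 ltr0n.
Qed.

Lemma scheme_4F_conserves_mass (fl : flux_kind) (tau : R) :
  tau != 0 -> conserves_mass (scheme_4F fl tau).
Proof.
move=> tau0; have beta1_gt := beta1_gt.
have beta1_neq0 : beta1 R != 0 by apply/eqP; lra.
have beta2_neq0 : beta2 R != 0 by apply/eqP; rewrite /beta2; lra.
apply: compose_conserves_mass.
  by apply: scheme_4_conserves_mass; rewrite mulf_neq0.
by apply: compose_conserves_mass; apply: scheme_4_conserves_mass;
  rewrite mulf_neq0.
Qed.

End PhaseSpace.

Theorem theorem3p8 (R : realType) (L Vc : R) (k : nat)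
    (Mx : mesh 0 L k) (Mv : mesh (- Vc) Vc k) (fl : flux_kind) (dt : R)
    (f : nat -> pwpoly2 Mx Mv) (E : nat -> pwpoly Mx) :
  0 < L -> 0 < Vc -> 0 < dt ->
  in_Qk (f 0%N) -> in_Pk (E 0%N) ->
  (forall n, zero_at_v_boundary (f n)) ->
  (forall n, scheme_4 fl dt (f n, E n) (f n.+1, E n.+1)) \/
  (forall n, scheme_4F fl dt (f n, E n) (f n.+1, E n.+1)) ->
  forall n,
    \int[lebesgue_measure]_(x in `[0, L])
      \int[lebesgue_measure]_(v in `[- Vc, Vc]) pwfun2 (f n.+1) x v
    = \int[lebesgue_measure]_(x in `[0, L])
        \int[lebesgue_measure]_(v in `[- Vc, Vc]) pwfun2 (f n) x v.
Proof.
move=> _ _ dt0 Qf0 _ f_zero scheme.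
have dt_neq0 : dt != 0 by rewrite gt_eqF.
have [wx wxP] := gauss_weightsP Mx; have [wv wvP] := gauss_weightsP Mv.
have step n : in_Qk (f n) ->
    in_Qk (f n.+1) /\ gauss_mass wx wv (f n.+1) = gauss_mass wx wv (f n).
  move=> Qf; case: scheme => scheme.
    apply: (scheme_4_conserves_mass wxP wvP dt_neq0 _ _ _ (scheme n)) => //=;
      exact: f_zero.
  apply: (scheme_4F_conserves_mass wxP wvP dt_neq0 _ _ _ (scheme n)) => //=;
    exact: f_zero.
(* The degree bound is assumed at time 0 only and is propagated by the scheme. *)
have Qf n : in_Qk (f n) by elim: n => // n /step[].
move=> n; rewrite !(double_integralE wxP wvP) //.
by case: (step n (Qf n)).
Qed.
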